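(* Let $X_n$ denote the number of triangles in the random graph $G(n,\tfrac12)$. For every positive integer $n$ and every real $t\ge 0$, $$\log \Pr(X_n\le t)\le -\Phi_n\big(t+n^{23/8}\big)+2n^{15/8}.$$
   Context: Write $[n]=\{1,\dots,n\}$ and let $\binom{[n]}{2}$ be the edge set of the complete graph $K_n$ on $[n]$. For a function $q:\binom{[n]}{2}\to[0,1]$, $G(n,q)$ denotes the random graph on $[n]$ obtained by retaining each edge $e$ of $K_n$ independently with probability $q_e$; $G(n,\frac12)$ is the case $q\equiv\frac12$. $N_{K_3}(G)$ is the number of triangles in $G$. For $t\ge0$ let $$\mathcal Q_t=\Big\{q\in[0,1]^{\binom{[n]}{2}}:\ \mathbb E\big[N_{K_3}(G(n,q))\big]\le t\Big\}$$ and $$\Phi_n(t)=\min\Big\{\sum_{e\in\binom{[n]}{2}}\big(q_e\log q_e+(1-q_e)\log(1-q_e)+\log 2\big):\ q\in\mathcal Q_t\Big\}.$$ Logarithms are natural and $0\log 0=0$. *)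

(* Defs.v *)
From HB Require Import structures.
From mathcomp Require Import all_boot all_order all_algebra.
From mathcomp Require Import all_classical all_reals all_analysis.

Set Implicit Arguments.
Unset Strict Implicit.
Unset Printing Implicit Defensive.

Import Order.TTheory GRing.Theory Num.Theory numFieldNormedType.Exports.

Local Open Scope classical_set_scope.
Local Open Scope ring_scope.

(* The vertex set is {0, ..., n-1}. *)
Definition edge (n : nat) := {e : {set 'I_n} | #|e| == 2%N}.

(* A simple graph on the n vertices is identified with its edge set. *)
Definition graph (n : nat) := {set edge n}.

Definition ntriangles (n : nat) (G : graph n) : nat :=
  #|[set T : {set 'I_n} | (#|T| == 3%N) &&
      [forall e : edge n, (val e \subset T) ==> (e \in G)]]%SET|.

Section RandomGraph.
Variable R : realType.

(* Probability that G(n, q) = G, the edges being retained independently. *)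
Definition gnq_mass (n : nat) (q : edge n -> R) (G : graph n) : R :=
  (\prod_(e in G) q e) * (\prod_(e in ~: G) (1 - q e)).

Definition gnq_prob (n : nat) (q : edge n -> R) (A : pred (graph n)) : R :=
  \sum_(G : graph n | A G) gnq_mass q G.

Definition gnq_expect (n : nat) (q : edge n -> R) (X : graph n -> R) : R :=
  \sum_(G : graph n) gnq_mass q G * X G.

Definition Qset (n : nat) (t : R) : set (edge n -> R) :=
  [set q | (forall e, 0 <= q e <= 1) /\
           gnq_expect q (fun G => (ntriangles G)%:R) <= t].
Arguments Qset : clear implicits.

(* As ln 0 = 0 in the library, the convention 0 log 0 = 0 holds. *)
Definition entropy_cost (n : nat) (q : edge n -> R) : R :=
  \sum_(e : edge n) (q e * ln (q e) + (1 - q e) * ln (1 - q e) + ln 2).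

(* For 0 <= t this infimum is a minimum, see [Phi_attained]. *)
Definition Phi (n : nat) (t : R) : R :=
  inf [set entropy_cost q | q in Qset n t].

Lemma continuous_xlnx : continuous (fun x : R => x * ln x).
Proof.
move=> x; have [x0|x0|->] := ltgtP x 0.
- apply: (near_cst_continuous 0); near=> y.
  rewrite ln0 ?mulr0// ltW//; near: y; exact: lt_nbhsl.
- by apply: cvgM; [exact: cvg_id | exact: continuous_ln].
rewrite /continuous_at mul0r.
have bnd (y : R) : 0 < y < 1 -> `|y * ln y| <= 2 * Num.sqrt y.
  move=> /andP[y0 y1]; have s0 : 0 < Num.sqrt y by rewrite sqrtr_gt0.
  have l0 : ln y <= 0 by rewrite ln_le0// ltW.
  rewrite normrM gtr0_norm// ler0_norm//.
  have := ln_sublinear (_ : 0 < (Num.sqrt y)^-1).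
  rewrite invr_gt0 => /(_ s0); rewrite lnV ?posrE// => h.
  have -> : ln y = 2 * ln (Num.sqrt y).
    by rewrite -{1}(sqr_sqrtr (ltW y0)) lnXn// mulr_natl.
  rewrite -mulrN mulrCA ler_pM2l//.
  rewrite -{1}(sqr_sqrtr (ltW y0)) expr2 -mulrA ger_pMr//.
  by rewrite -(@divff _ (Num.sqrt y)) ?gt_eqF// ler_pM2l// ltW.
have sq : 2 * Num.sqrt y @[y --> (0:R)] --> (0:R).
  rewrite -[X in _ --> X](mulr0 2) -{2}(sqrtr0 R).
  by apply: cvgM; [exact: cvg_cst | exact: sqrt_continuous].
have nsq : - (2 * Num.sqrt y) @[y --> (0:R)] --> (0:R).
  by rewrite -[X in _ --> X](@oppr0 R); exact: cvgN sq.
apply: (squeeze_cvgr _ nsq sq); near=> y.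
rewrite -ler_norml; have [y0|y0] := ltP 0 y.
  by apply: bnd; rewrite y0; near: y; exact: lt_nbhsl.
by rewrite ln0// mulr0 normr0 mulr_ge0 ?sqrtr_ge0.
Unshelve. all: by end_near. Qed.

Lemma continuous_gnq_expect (T : topologicalType) (n : nat)
    (p : T -> edge n -> R) (X : graph n -> R) :
  (forall e, continuous (p^~ e)) ->
  continuous (fun x => gnq_expect (p x) X).
Proof.
move=> cp; apply: continuous_big => [|G _ x]; first exact: add_continuous.
apply: cvgM; last exact: cvg_cst.
apply: cvgM; apply: (cvg_big (@mul_continuous R)) => e _; first exact: cp.
by apply: cvgB; [exact: cvg_cst | exact: cp].
Qed.

Lemma continuous_entropy_cost (T : topologicalType) (n : nat)
    (p : T -> edge n -> R) :
  (forall e, continuous (p^~ e)) ->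
  continuous (fun x => entropy_cost (p x)).
Proof.
move=> cp; apply: continuous_big => [|e _ x]; first exact: add_continuous.
apply: cvgD; last exact: cvg_cst.
apply: cvgD.
  exact: (continuous_comp (cp e x) (@continuous_xlnx _)).
apply: (@continuous_comp _ _ _ (fun x => 1 - p x e) (fun y => y * ln y)
  x _ (@continuous_xlnx _)).
by apply: cvgB; [exact: cvg_cst | exact: cp].
Qed.

Lemma Phi_attained (n : nat) (t : R) : 0 <= t ->
  exists q, [/\ Qset n t q,
    forall q', Qset n t q' -> entropy_cost q <= entropy_cost q'
    & Phi n t = entropy_cost q].
Proof.
move=> t0.
pose T := prod_topology (fun _ : edge n => (R : topologicalType)).
have cproj e : continuous (fun q : T => q e) by exact: proj_continuous.
have cE : continuous
    (fun q : T => gnq_expect q (fun G => (ntriangles G)%:R)).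
  exact: (@continuous_gnq_expect T n id).
have cI : continuous (fun q : T => entropy_cost q).
  exact: (@continuous_entropy_cost T n id).
have cQ : @compact T (Qset n t).
  have -> : Qset n t = [set q : T | forall e, `[0, 1]%classic (q e)] `&`
      ((fun q : T => gnq_expect q (fun G => (ntriangles G)%:R)) @^-1`
        [set x | x <= t]).
    apply/seteqP; split=> q /= [h1 h2]; split=> // e;
      by have := h1 e; rewrite /= in_itv.
  apply: compact_closedI.
    exact: (@tychonoff _ (fun=> R) (fun=> `[0, 1]%classic)
      (fun=> @segment_compact R 0 1)).
  by have /continuous_closedP := cE; apply; exact: closed_le.
have Q0 : Qset n t !=set0.
  exists (fun _ => 0); split=> [e|]; first by rewrite lexx ler01.
  rewrite /gnq_expect big1// => G _.
  have [->|/set0Pn[e eG]] := eqVneq G finset.set0; last first.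
    by rewrite /gnq_mass (bigD1 e)//= !mul0r.
  rewrite /ntriangles (_ : [set _ | _]%SET = finset.set0) ?cards0 ?mulr0//.
  apply/setP => A; rewrite !inE; apply/negbTE/negP => /andP[A3 /forallP h].
  have /card_gt0P[a aA] : (0 < #|A|)%N by rewrite (eqP A3).
  have c2 : #|(A :\ a)%SET| == 2%N by move: A3; rewrite (cardsD1 a) aA.
  by have := h (Sub (A :\ a)%SET c2); rewrite SubK subD1set inE.
have [q Qq qmin] := @compact_EVT_min T R (fun q => entropy_cost q) _ Q0 cQ
  (continuous_subspaceT cI).
have {}qmin q' : Qset n t q' -> entropy_cost q <= entropy_cost q'.
  by move=> Qq'; apply: qmin; rewrite inE.
move: Qq; rewrite inE => Qq; exists q; split=> //.
apply/eqP; rewrite eq_le; apply/andP; split.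
  apply: ge_inf; last by exists q.
  by exists (entropy_cost q) => _ [q' Qq' <-]; exact: qmin.
by apply: lb_le_inf => [|_ [q' Qq' <-]]; [exists (entropy_cost q), q | exact: qmin].
Qed.

End RandomGraph.

Arguments Qset {R} n%_N t%_R _.
Arguments Phi {R} n%_N t%_R.

(* Main.v *)
Require Import Defs.
From mathcomp Require Import all_boot all_order all_algebra.
From mathcomp Require Import all_classical all_reals all_analysis.
From mathcomp Require Import ring lra.

(** Let [F] be the family of graphs with at most [t] triangles, with its
    uniform law, so that the probability to bound is [#|F| / 2 ^ N] with [N]
    the number of edges of the complete graph. Entropy is subadditive
    ([entropy_subadditive]): for every family [H] of graphs with edge densities
    [q], [ln #|H| - N ln 2] is at most [- entropy_cost q]. With [H = F] this
    would give the theorem if the graph [G(n, q)] had few triangles on average,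
    but the edges of a random member of [F] may be strongly correlated.

    The remedy is to condition on the edges that meet a small set [W] of
    vertices, chosen so that few correlations remain within triangles. Consider
    the energy of [W], the sum over [F] and over all edges of the squared
    conditional edge densities given the edges meeting [W]. It is at most
    [#|F| n ^ 2] and never decreases as [W] grows, so for some [W] with at most
    [n ^ (1/4)] vertices no further vertex increases it by much
    ([exists_saturated]). For such [W], revealing one more vertex [w] hardly
    changes, on average, the conditional density of an edge [uv]
    ([sum_edge_dev_le]). But revealing [w] determines the edges [uw] and [vw],
    so [uv] is almost uncorrelated with any event about those two
    ([cmean_cov_le]), and the conditional probability of the triangle [uvw] is
    close to the product of the three conditional densities
    ([triangle_defect]).

    Every fiber of the conditioning consists of graphs with at most [t]
    triangles. Hence, for the conditional densities [q] of a typical fiber,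
    [G(n, q)] has at most [t + n ^ (23/8)] triangles on average
    ([ntriangles_density]). There are at most [2 ^ (n ^ (5/4))] fibers, so a
    typical fiber can also be chosen with at least
    [#|F| / 2 ^ (n ^ (5/4) + 1)] elements ([exists_large_fiber]). Subadditivity
    of entropy on that fiber gives the theorem, the loss
    [(n ^ (5/4) + 1) ln 2] being below [2 n ^ (15/8)]. *)

Set Implicit Arguments.
Unset Strict Implicit.
Unset Printing Implicit Defensive.

Import Order.TTheory GRing.Theory Num.Theory.

Local Open Scope ring_scope.

(** * Conditional means on a finite uniform space *)

Definition refines (T : Type) (U V : eqType) (k' : T -> U) (k : T -> V) :=
  forall x y, k' x = k' y -> k x = k y.

Section ConditionalMean.
Variables (R : realType) (T : finType) (F : {set T}).

Definition fiber (U : eqType) (k : T -> U) (x : T) : {set T} :=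
  [set y in F | k y == k x]%SET.

Definition cmean (U : eqType) (k : T -> U) (f : T -> R) (x : T) : R :=
  (\sum_(y in fiber k x) f y) / #|fiber k x|%:R.

Lemma mem_fiber (U : eqType) (k : T -> U) x : x \in F -> x \in fiber k x.
Proof. by rewrite inE eqxx => ->. Qed.

Lemma fiber_card_gt0 (U : eqType) (k : T -> U) x :
  x \in F -> 0 < #|fiber k x|%:R :> R.
Proof. by move=> xF; rewrite ltr0n; apply/card_gt0P; exists x; exact: mem_fiber. Qed.

Lemma eq_fiber (U : eqType) (k : T -> U) x y : k x = k y -> fiber k x = fiber k y.
Proof. by move=> kxy; apply/setP => z; rewrite !inE kxy. Qed.

Lemma eq_cmean_key (U : eqType) (k : T -> U) f x y :
  k x = k y -> cmean k f x = cmean k f y.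
Proof. by rewrite /cmean => /eq_fiber ->. Qed.

Lemma eq_cmean (U : eqType) (k : T -> U) f g x :
  (forall y, y \in F -> f y = g y) -> cmean k f x = cmean k g x.
Proof.
move=> fg; congr (_ / _); apply: eq_bigr => y.
by rewrite inE => /andP[/fg].
Qed.

Lemma cmeanZ (U : eqType) (k : T -> U) c f x :
  cmean k (fun y => c * f y) x = c * cmean k f x.
Proof. by rewrite /cmean -mulr_sumr mulrA. Qed.

Lemma cmeanB (U : eqType) (k : T -> U) f g x :
  cmean k (fun y => f y - g y) x = cmean k f x - cmean k g x.
Proof. by rewrite /cmean sumrB mulrBl. Qed.

Lemma cmean_sum (U : eqType) (k : T -> U) (I : finType) (P : pred I)
    (f : I -> T -> R) x :
  cmean k (fun y => \sum_(i | P i) f i y) x = \sum_(i | P i) cmean k (f i) x.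
Proof. by rewrite /cmean exchange_big mulr_suml. Qed.

Lemma le_cmean (U : eqType) (k : T -> U) f g x :
  (forall y, y \in F -> f y <= g y) -> cmean k f x <= cmean k g x.
Proof.
move=> fg; rewrite ler_wpM2r ?invr_ge0 ?ler0n//; apply: ler_sum => y.
by rewrite inE => /andP[/fg].
Qed.

Lemma cmean_pull (U : eqType) (k : T -> U) f g x :
  (forall y z, k y = k z -> g y = g z) ->
  cmean k (fun y => f y * g y) x = cmean k f x * g x.
Proof.
move=> kg; rewrite /cmean mulrAC; congr (_ / _); rewrite mulr_suml.
by apply: eq_bigr => y; rewrite inE => /andP[_ /eqP /kg ->].
Qed.

Lemma cmean_cst (U : eqType) (k : T -> U) c x :
  x \in F -> cmean k (fun _ => c) x = c.
Proof.
move=> xF; rewrite /cmean sumr_const -[c *+ _]mulr_natr mulfK//.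
exact/lt0r_neq0/fiber_card_gt0.
Qed.

Lemma cmean_id (U : eqType) (k : T -> U) g x :
  x \in F -> (forall y z, k y = k z -> g y = g z) -> cmean k g x = g x.
Proof.
move=> xF kg; have := cmean_pull (fun=> 1) x kg.
by rewrite cmean_cst// mul1r => <-; apply: eq_cmean => y _; rewrite mul1r.
Qed.

Lemma cmean_ge0 (U : eqType) (k : T -> U) f x :
  (forall y, 0 <= f y) -> 0 <= cmean k f x.
Proof. by move=> f0; rewrite divr_ge0 ?sumr_ge0. Qed.

(** Conditional expectation is a self-adjoint operator: both sides sum
    [f y * g x / #|fiber k x|] over the pairs lying in a common fiber. *)
Lemma sum_cmean_mul (U : eqType) (k : T -> U) f g :
  \sum_(x in F) cmean k f x * g x = \sum_(x in F) f x * cmean k g x.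
Proof.
have E h1 h2 : \sum_(x in F) cmean k h1 x * h2 x = \sum_(x in F)
    \sum_(y in F) (if k y == k x then h1 y * h2 x / #|fiber k x|%:R else 0).
  apply: eq_bigr => x xF; rewrite -big_mkcondr /= mulrAC !mulr_suml.
  by apply: eq_bigl => y; rewrite inE.
rewrite E exchange_big -[RHS](eq_bigr _ (fun _ _ => mulrC _ _)) E /=.
apply: eq_bigr => x _; apply: eq_bigr => y _; rewrite eq_sym.
by case: eqP => // kyx; rewrite (eq_fiber kyx) [h1 in h1 / _]mulrC.
Qed.

Lemma sum_cmean (U : eqType) (k : T -> U) f :
  \sum_(x in F) cmean k f x = \sum_(x in F) f x.
Proof.
transitivity (\sum_(x in F) cmean k f x * 1); first by under [RHS]eq_bigr do rewrite mulr1.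
rewrite sum_cmean_mul; apply: eq_bigr => x xF.
by rewrite cmean_cst// mulr1.
Qed.

Lemma cmean_tower (U V : eqType) (k' : T -> U) (k : T -> V) f x :
  refines k' k -> cmean k (cmean k' f) x = cmean k f x.
Proof.
move=> k'k; rewrite /cmean; congr (_ / _).
pose g y : R := (k y == k x)%:R.
have E h : \sum_(y in fiber k x) h y = \sum_(y in F) h y * g y.
  rewrite (eq_bigl (fun y => (y \in F) && (k y == k x))) => [|y]; last by rewrite inE.
  rewrite big_mkcondr; apply: eq_bigr => y _; rewrite /g.
  by case: eqP; rewrite ?mulr1 ?mulr0.
rewrite !E sum_cmean_mul; apply: eq_bigr => y yF; congr (_ * _).
by rewrite -[LHS]/(cmean k' g y) cmean_id// => z1 z2 /k'k; rewrite /g => ->.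
Qed.

(** Pythagoras: the conditional mean with respect to the coarser key is the
    orthogonal projection of the finer one, so the mean square grows exactly
    by the squared distance between the two. *)
Lemma sum_cmean_sqrB (U V : eqType) (k' : T -> U) (k : T -> V) f :
  refines k' k ->
  \sum_(x in F) (cmean k' f x - cmean k f x) ^+ 2 =
  \sum_(x in F) cmean k' f x ^+ 2 - \sum_(x in F) cmean k f x ^+ 2.
Proof.
move=> k'k.
have cross : \sum_(x in F) cmean k' f x * cmean k f x =
    \sum_(x in F) cmean k f x ^+ 2.
  rewrite -[RHS]/(\sum_(x in F) cmean k f x * cmean k f x) [RHS]sum_cmean_mul.
  rewrite sum_cmean_mul; apply: eq_bigr => x xF; congr (_ * _).
  rewrite (cmean_tower _ _ (fun _ _ => id)) cmean_id// => y z /k'k.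
  exact: eq_cmean_key.
under eq_bigr do rewrite sqrrB.
by rewrite big_split sumrB /= sumrMnl cross mulr2n; ring.
Qed.

(** If the finer key [k'] determines the event [b], then the covariance of [f]
    with [b] inside a fiber of [k] is the covariance of [cmean k' f] with [b].
    Centering [b] at [1/2] costs nothing because [cmean k' f - cmean k f] has
    mean zero there, and it turns the bound [|b| <= 1] into [|b - 1/2| <= 1/2]. *)
Lemma cmean_cov_le (U V : eqType) (k' : T -> U) (k : T -> V) f (b : T -> bool) x :
  x \in F -> refines k' k -> (forall y z, k' y = k' z -> b y = b z) ->
  cmean k f x * cmean k (fun y => (b y)%:R) x - cmean k (fun y => f y * (b y)%:R) x
    <= 2^-1 * cmean k (fun y => `|cmean k' f y - cmean k f y|) x.
Proof.
move=> xF k'k k'b; pose d y := cmean k' f y - cmean k f y.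
have dE g : cmean k (fun y => d y * g y) x =
    cmean k (fun y => cmean k' f y * g y) x - cmean k f x * cmean k g x.
  rewrite -[cmean k f x * _]mulrC -cmean_pull; last exact: eq_cmean_key.
  by rewrite -cmeanB; apply: eq_cmean => y _; rewrite /d; ring.
have d0 : cmean k d x = 0.
  have := dE (fun=> 1); rewrite cmean_cst// mulr1.
  have one h : cmean k (fun y => h y * 1) x = cmean k h x.
    by apply: eq_cmean => y _; rewrite mulr1.
  by rewrite !one cmean_tower// subrr.
have -> : cmean k (fun y => f y * (b y)%:R) x =
    cmean k (fun y => cmean k' f y * (b y)%:R) x.
  rewrite -(cmean_tower _ _ k'k); apply: eq_cmean => y _.
  by rewrite cmean_pull// => y1 y2 /k'b ->.
rewrite -opprB -dE -[X in X <= _]addr0 -(mulr0 2^-1) -d0 addrC -!cmeanZ -cmeanB.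
apply: le_cmean => y _.
by rewrite /d; case: (b y) => /=; case: ler0P => ?; lra.
Qed.

(** Every fiber contributes a total weight [1]. *)
Lemma sum_inv_fiber (U : finType) (k : T -> U) :
  \sum_(x in F) (#|fiber k x|%:R : R)^-1 = #|k @: F|%SET%:R.
Proof.
rewrite (partition_big_imset k)/= -sum1_card natr_sum; apply: eq_bigr => _ /imsetP[x xF ->].
transitivity (\sum_(y in F | k y == k x) (#|fiber k x|%:R : R)^-1).
  by apply: eq_bigr => y /andP[_ /eqP kyx]; rewrite (eq_fiber kyx).
transitivity (\sum_(y in fiber k x) (#|fiber k x|%:R : R)^-1).
  by apply: eq_bigl => y; rewrite inE.
rewrite sumr_const -[LHS]mulr_natr mulVf//; exact/lt0r_neq0/fiber_card_gt0.
Qed.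

End ConditionalMean.

(** Markov's inequality combined with pigeonhole. If every fiber with
    [h x <= d] had fewer than [#|F| / (2 #|k @: F|)] elements, then
    [d - h x < #|F| d / (2 #|k @: F| #|fiber F k x|)] would hold for all [x],
    and summing with [sum_inv_fiber] would contradict the bound on the sum
    of [h]. *)
Lemma exists_large_fiber (R : realType) (T U : finType) (F : {set T})
    (k : T -> U) (h : T -> R) (d : R) :
  (0 < #|F|)%N -> 0 < d -> (forall x, x \in F -> 0 <= h x) ->
  \sum_(x in F) h x <= #|F|%:R * d / 2 ->
  exists x, [/\ x \in F, h x <= d &
    #|F|%:R <= 2 * #|k @: F|%SET%:R * #|fiber F k x|%:R :> R].
Proof.
move=> F0 d0 h0 hd; apply: contrapT => none.
set K : R := #|k @: F|%SET%:R.
have K0 : 0 < K.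
  by rewrite ltr0n card_gt0 imset_eq0 -card_gt0.
have c0 : 0 < #|F|%:R :> R by rewrite ltr0n.
have bound x : x \in F -> d - h x < #|F|%:R * d / 2 / K * #|fiber F k x|%:R^-1.
  move=> xF; have f0 := @fiber_card_gt0 R T F U k x xF.
  rewrite ltr_pdivlMr// ltr_pdivlMr// ltr_pdivlMr//.
  (* Above the threshold the left-hand side is negative. *)
  have [hx|hx] := lerP (h x) d; last first.
    rewrite (@le_lt_trans _ _ 0) ?mulr_gt0// -!mulrA mulr_le0_ge0 ?mulr_ge0 ?ltW//.
    by rewrite subr_lt0.
  have lt : 2 * K * #|fiber F k x|%:R < #|F|%:R.
    by rewrite ltNge; apply/negP => big; apply: none; exists x.
  apply: (@le_lt_trans _ _ (d * #|fiber F k x|%:R * K * 2)); last first.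
    have -> : d * #|fiber F k x|%:R * K * 2 = d * (2 * K * #|fiber F k x|%:R) by ring.
    by rewrite [X in _ < X]mulrC ltr_pM2l.
  by rewrite !ler_pM2r// lerBlDr lerDl h0.
have /card_gt0P[x0 x0F] := F0.
have : \sum_(x in F) (d - h x) <
    \sum_(x in F) #|F|%:R * d / 2 / K * #|fiber F k x|%:R^-1.
  by apply: ltr_sum => //; apply/hasP; exists x0; rewrite ?mem_index_enum.
rewrite -mulr_sumr sum_inv_fiber sumrB sumr_const mulfVK ?gt_eqF//.
by rewrite -mulr_natl; lra.
Qed.

(** * Entropy of a family of graphs *)

Section ProductMeasure.
Variables (R : realType) (n : nat).
Implicit Types (q : edge n -> R) (G : graph n) (F : {set graph n}).

Lemma gnq_massE q G :
  gnq_mass q G = \prod_e (if e \in G then q e else 1 - q e).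
Proof.
rewrite /gnq_mass [RHS](bigID (mem G))/=; congr (_ * _).
  by apply: eq_bigr => e ->.
rewrite (eq_bigl (fun e => e \notin G)) => [|e]; last by rewrite inE.
by apply: eq_bigr => e /negbTE ->.
Qed.

(** The indicator of [A \subset G] amounts to suppressing the absent branch of
    every edge of [A] in the expanded product [\prod_e (q e + (1 - q e))]. *)
Lemma gnq_expect_subset q (A : graph n) :
  gnq_expect q (fun G => (A \subset G)%:R) = \prod_(e in A) q e.
Proof.
transitivity (\prod_e (q e + if e \in A then 0 else 1 - q e)); last first.
  rewrite (big_mkcond (mem A))/=; apply: eq_bigr => e _.
  by case: ifP => _; [rewrite addr0 | rewrite addrC subrK].
rewrite bigA_distr; apply: eq_bigr => G _; rewrite gnq_massE.
have [AG|/subsetPn[e eA eG]] := boolP (A \subset G); last first.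
  by rewrite mulr0 [RHS](bigD1 e)//= (negbTE eG) eA mul0r.
rewrite mulr1; apply: eq_bigr => e _; case: ifP => // /negbT eG.
by case: ifP => // /(fintype.subsetP AG); rewrite (negbTE eG).
Qed.

Lemma sum_gnq_mass q : \sum_G gnq_mass q G = 1.
Proof.
transitivity (gnq_expect q (fun G => (finset.set0 \subset G)%:R)).
  by apply: eq_bigr => G _; rewrite finset.sub0set mulr1.
by rewrite gnq_expect_subset big_set0.
Qed.

Definition density F (e : edge n) : R :=
  (\sum_(G in F) (e \in G)%:R) / #|F|%:R.

Lemma density_bounds F e : 0 <= density F e <= 1.
Proof.
rewrite /density divr_ge0 ?sumr_ge0//=.
have [F0|F0] := posnP #|F|; first by rewrite F0 invr0 mulr0.
rewrite ler_pdivrMr ?ltr0n// mul1r -sum1_card natr_sum.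
by apply: ler_sum => G _; case: (e \in G); rewrite ?ler01.
Qed.

Lemma density_compl F e : (0 < #|F|)%N ->
  1 - density F e = (\sum_(G in F) (e \notin G)%:R) / #|F|%:R.
Proof.
move=> F0; have nz : #|F|%:R != 0 :> R by rewrite pnatr_eq0 -lt0n.
rewrite /density -[X in X - _](mulfV nz) -mulrBl; congr (_ / _).
rewrite -sum1_card natr_sum -sumrB.
by apply: eq_bigr => G _; case: (e \in G) => /=; rewrite ?subrr ?subr0.
Qed.

Lemma sum_card_gt0 F (p : pred (graph n)) G : G \in F -> p G ->
  0 < (\sum_(H in F) (p H)%:R) / #|F|%:R :> R.
Proof.
move=> GF pG; rewrite divr_gt0//; last by rewrite ltr0n; apply/card_gt0P; exists G.
by rewrite (bigD1 G)//= pG ltr_wpDr// sumr_ge0.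
Qed.

Lemma ln_prod (I : finType) (f : I -> R) : (forall i, 0 < f i) ->
  ln (\prod_i f i) = \sum_i ln (f i).
Proof.
move=> f0; suff [_ ->] : 0 < \prod_i f i /\ ln (\prod_i f i) = \sum_i ln (f i) by [].
apply: (big_ind2 (fun x y => 0 < x /\ ln x = y)).
- by rewrite ln1 ltr01.
- by move=> x1 x2 y1 y2 [x1p <-] [y1p <-]; rewrite mulr_gt0// lnM ?posrE.
- by move=> i _; rewrite f0.
Qed.

(** Subadditivity of entropy for the uniform law on [F]: its entropy
    [ln #|F|] is at most the sum of the entropies of its edge marginals. The
    proof is Gibbs' inequality against the product law [mass] with the same
    marginals: [\sum_(G in F) ln (#|F| * mass G) <= 0] because
    [ln x <= x - 1] and [mass] has total weight [1], while [ln (mass G)] sums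
    over [F] to minus the marginal entropies times [#|F|]. *)
Lemma entropy_subadditive F : (0 < #|F|)%N ->
  ln #|F|%:R - #|{: edge n}|%:R * ln 2 <= - entropy_cost (density F).
Proof.
move=> F0; have c0 : 0 < #|F|%:R :> R by rewrite ltr0n.
have cnz : #|F|%:R != 0 :> R by exact: lt0r_neq0.
set q := density F.
have fac_gt0 G e : G \in F -> 0 < (if e \in G then q e else 1 - q e).
  move=> GF; case: ifP => [eG|/negbT eG]; first exact: (@sum_card_gt0 F (fun H => e \in H) G).
  by rewrite density_compl//; exact: (@sum_card_gt0 F (fun H => e \notin H) G).
have mass_gt0 G : G \in F -> 0 < gnq_mass q G.
  by move=> GF; rewrite gnq_massE prodr_gt0// => e _; exact: fac_gt0.
have gibbs : \sum_(G in F) ln (#|F|%:R * gnq_mass q G) <= 0.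
  apply: (@le_trans _ _ (\sum_(G in F) (#|F|%:R * gnq_mass q G - 1))).
    apply: ler_sum => G GF; rewrite -[X in ln X](subrK 1) addrC.
    by apply: le_ln1Dx; rewrite ltrBrDr addNr mulr_gt0// mass_gt0.
  rewrite sumrB -mulr_sumr sumr_const subr_le0 -[leRHS]mulr1 ler_pM2l//.
  rewrite -(sum_gnq_mass q) [leRHS](bigID (mem F))/= lerDl sumr_ge0// => G _.
  rewrite gnq_massE prodr_ge0// => e _.
  have /andP[q0 q1] := density_bounds F e.
  by case: ifP => // _; rewrite subr_ge0.
have lnE G : G \in F -> ln (#|F|%:R * gnq_mass q G) =
    ln #|F|%:R + \sum_e ((e \in G)%:R * ln (q e) + (e \notin G)%:R * ln (1 - q e)).
  move=> GF; rewrite lnM ?posrE ?mass_gt0//; congr (_ + _).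
  rewrite gnq_massE ln_prod => [|e]; last exact: fac_gt0.
  by apply: eq_bigr => e _; case: (e \in G) => /=; ring.
move: gibbs; rewrite (eq_bigr _ lnE) big_split /= sumr_const exchange_big /=.
have -> : \sum_e \sum_(G in F) ((e \in G)%:R * ln (q e) + (e \notin G)%:R * ln (1 - q e))
   = #|F|%:R * (entropy_cost q - #|{: edge n}|%:R * ln 2).
  have -> : #|{: edge n}|%:R * ln 2 = \sum_(e : edge n) ln 2 :> R.
    by rewrite sumr_const mulr_natl.
  rewrite /entropy_cost -sumrB mulr_sumr.
  apply: eq_bigr => e _; rewrite big_split/= -!mulr_suml addrK.
  by rewrite density_compl// /q /density; field.
by rewrite -[_ *+ _]mulr_natl -mulrDr pmulr_rle0// ; lra.
Qed.

End ProductMeasure.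

(** * Triangles and the exposure of vertices *)

Section Triangles.
Variables (R : realType) (n : nat).
Implicit Types (G : graph n) (T W : {set 'I_n}) (e : edge n).

Definition edges_in T : graph n := [set e : edge n | val e \subset T]%SET.

Definition touching W : graph n := [set e : edge n | ~~ [disjoint val e & W]]%SET.

(** What is revealed of [G] when the neighbourhoods of the vertices of [W] are
    inspected. *)
Definition expose W G : graph n := (G :&: touching W)%SET.

Lemma card_edge e : #|val e| = 2%N. Proof. exact/eqP/(valP e). Qed.

Lemma card_touching W : (#|touching W| <= #|W| * n)%N.
Proof.
pose mk (p : 'I_n * 'I_n) : {set 'I_n} := [set p.1; p.2]%SET.
have /leq_trans : (#|touching W| <= #|mk @: (finset.setX W [set: 'I_n]%SET)|)%N.
  rewrite -(card_imset _ val_inj); apply: subset_leq_card.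
  apply/fintype.subsetP => _ /imsetP[e + ->]; rewrite inE => /pred0Pn[w /andP[/= we wW]].
  have : #|(val e :\ w)%SET| == 1%N by have := card_edge e; rewrite (cardsD1 w) we add1n => -[->].
  move=> /cards1P[x ex]; apply/imsetP; exists (w, x); first by rewrite !inE wW.
  by rewrite /mk/= -(finset.setD1K we) ex.
by apply; rewrite (leq_trans (leq_imset_card _ _))// cardsX cardsT card_ord.
Qed.

Lemma card_edge_le : (#|{: edge n}| <= n * n)%N.
Proof.
have := card_touching [set: 'I_n]%SET; rewrite cardsT card_ord; apply: leq_trans.
rewrite -cardsT subset_leq_card//; apply/fintype.subsetP => e _.
rewrite inE; have /card_gt0P[x xe] : (0 < #|val e|)%N by rewrite card_edge.
by apply/pred0Pn; exists x; rewrite /= xe inE.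
Qed.

Lemma expose_refines W x : refines (expose (x |: W)%SET) (expose W).
Proof.
move=> G H /setP GH; apply/setP => e; have := GH e; rewrite !inE.
have [//|eW] := boolP [disjoint _ & W]; first by rewrite !andbF.
have -> // : ~~ [disjoint val e & (x |: W)%SET].
by apply: contra eW; apply: disjointWr; rewrite finset.subsetUr.
Qed.

Lemma mem_expose W x e G H : x \in val e ->
  expose (x |: W)%SET G = expose (x |: W)%SET H -> (e \in G) = (e \in H).
Proof.
move=> xe /setP/(_ e); rewrite !inE.
have -> : ~~ [disjoint val e & (x |: W)%SET].
  by apply/pred0Pn; exists x; rewrite /= xe !inE eqxx.
by rewrite !andbT.
Qed.

Lemma ntrianglesE G :
  (ntriangles G)%:R = \sum_(T : {set 'I_n} | #|T| == 3%N) (edges_in T \subset G)%:R :> R.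
Proof.
rewrite /ntriangles -sum1_card natr_sum.
rewrite (eq_bigl (fun T : {set 'I_n} => (#|T| == 3%N) && (edges_in T \subset G))).
  by rewrite big_mkcondr; apply: eq_bigr => T _; case: ifP.
move=> T; rewrite inE; congr (_ && _); apply/forallP/fintype.subsetP => h e.
  by rewrite inE => eT; have := h e; rewrite eT.
by apply/implyP => eT; apply: h; rewrite inE.
Qed.

(** Each edge of a triangle contains the vertex opposite to any other edge, so
    revealing a single vertex determines two of the three edges and leaves the
    opposite one open. *)
Lemma card3_edges T : #|T| = 3%N -> exists (u v w : 'I_n) (a b c : edge n),
  [/\ edges_in T = [set a; b; c]%SET, [/\ a != b, a != c & b != c],
      (w |: val c)%SET = T, (v |: val a)%SET = T &
      [/\ w \in val a, w \in val b & v \in val b]].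
Proof.
move=> T3; have /card_gt0P[w wT] : (0 < #|T|)%N by rewrite T3.
have /cards2P[u [v [uv Tw]]] : #|(T :\ w)%SET| == 2%N.
  by have := T3; rewrite (cardsD1 w) wT add1n => -[->].
have Tuvw : T = (w |: [set u; v])%SET by rewrite -Tw finset.setD1K.
have [wu wv] : w != u /\ w != v.
  have : w \notin [set u; v]%SET by rewrite -Tw !inE eqxx.
  by rewrite !inE negb_or => /andP[].
have pair (x y : 'I_n) : x != y -> #|[set x; y]%SET| == 2%N by move=> xy; rewrite cards2 xy.
have uw : u != w by rewrite eq_sym.
have vw : v != w by rewrite eq_sym.
have vu : v != u by rewrite eq_sym.
pose a : edge n := Sub [set u; w]%SET (pair _ _ uw).
pose b : edge n := Sub [set v; w]%SET (pair _ _ vw).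
pose c : edge n := Sub [set u; v]%SET (pair _ _ uv).
have neq (e f : edge n) x : x \in val e -> x \notin val f -> e != f.
  by move=> xe; apply: contraNneq => <-.
exists u, v, w, a, b, c; split.
- apply/setP => e; rewrite !inE.
  apply/idP/idP => [eT|]; last first.
    by case/orP=> [/orP[]|] /eqP -> /=; apply/fintype.subsetP => x;
      rewrite Tuvw !inE => /orP[]->; rewrite ?orbT.
  have : #|(T :\: val e)%SET| == 1%N by rewrite cardsDS// T3 card_edge.
  move=> /cards1P[x Tx].
  have eE : val e = (T :\ x)%SET.
    by rewrite -Tx finset.setDDr finset.setDv finset.set0U; apply/esym/finset.setIidPr.
  have : x \in T by have : x \in (T :\: val e)%SET by [rewrite Tx inE]; rewrite inE => /andP[].
  rewrite Tuvw !inE => /orP[/eqP xE|/orP[]/eqP xE].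
  + suff -> : e = c by rewrite eqxx !orbT.
    by apply: val_inj; rewrite eE xE Tw.
  + suff -> : e = b by rewrite eqxx !orbT.
    apply: val_inj; rewrite eE xE Tuvw /=; apply/setP => y; rewrite !inE.
    by have [->|_] := eqVneq y u; rewrite /= ?(negbTE uv) ?(negbTE uw)// orbC.
  + suff -> : e = a by rewrite eqxx.
    apply: val_inj; rewrite eE xE Tuvw /=; apply/setP => y; rewrite !inE.
    have [->|_] := eqVneq y v; rewrite /= ?(negbTE vu) ?(negbTE vw)//.
    by rewrite orbF orbC.
- split; [apply: (neq _ _ u)|apply: (neq _ _ w)|apply: (neq _ _ w)];
  by rewrite !inE ?eqxx ?orbT// ?negb_or ?uv ?wu ?wv// eq_sym.
- by rewrite Tuvw.
- by rewrite Tuvw; apply/setP => y; rewrite !inE orbA orbC; congr (_ || _); rewrite orbC.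
- by rewrite !inE !eqxx ?orbT.
Qed.

End Triangles.

(** * The triangle count under the conditional edge densities *)

Section TriangleDefect.
Variables (R : realType) (n : nat) (F : {set graph n}).
Implicit Types (G : graph n) (T W : {set 'I_n}) (e : edge n).

Definition edge_mean W e : graph n -> R :=
  cmean F (expose W) (fun G => (e \in G)%:R).

Definition edge_shift W (p : edge n * 'I_n) G : R :=
  edge_mean (p.2 |: W)%SET p.1 G - edge_mean W p.1 G.

(** How much revealing one more vertex [p.2] is expected to move the density
    of the edge [p.1], given what [W] reveals. *)
Definition edge_dev W p : graph n -> R :=
  cmean F (expose W) (fun G => `|edge_shift W p G|).

Lemma edge_dev_ge0 W p G : 0 <= edge_dev W p G.
Proof. exact: cmean_ge0. Qed.

(** For a triangle on [u], [v], [w] with edges [a = uw], [b = vw], [c = uv],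
    the defect splits as [q c * (q a q b - E(ab)) + (q c E(ab) - E(abc))].
    Revealing [w] determines [ab], and revealing [v] determines [b], so
    [cmean_cov_le] applies to both covariances. *)
Lemma triangle_defect W T G : G \in F -> #|T| = 3%N ->
  \prod_(e in edges_in T) edge_mean W e G -
    cmean F (expose W) (fun H => (edges_in T \subset H)%:R) G <=
  2^-1 * \sum_(p : edge n * 'I_n | (p.2 |: val p.1)%SET == T) edge_dev W p G.
Proof.
move=> GF /card3_edges[u [v [w [a [b [c]]]]]].
move=> [-> [ab ac bc] wc va [wa wb vb]].
have mean01 e : 0 <= edge_mean W e G <= 1 by exact: density_bounds.
have dev2 : edge_dev W (c, w) G + edge_dev W (a, v) G <=
    \sum_(p : edge n * 'I_n | (p.2 |: val p.1)%SET == T) edge_dev W p G.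
  rewrite (bigD1 (c, w)) /= ?wc// (bigD1 (a, v)) /= ?va ?eqxx ?xpair_eqE ?(negbTE ac)//.
  by rewrite addrA lerDl sumr_ge0// => p _; exact: edge_dev_ge0.
have prodE : \prod_(e in [set a; b; c]%SET) edge_mean W e G =
    edge_mean W a G * edge_mean W b G * edge_mean W c G.
  rewrite finset.setUC big_setU1 ?big_setU1 ?big_set1 /=; first by ring.
    by rewrite inE.
  by rewrite !inE negb_or eq_sym ac eq_sym bc.
have subE (H : graph n) : ([set a; b; c]%SET \subset H) = (a \in H) && (b \in H) && (c \in H).
  by rewrite !finset.subUset !finset.sub1set.
pose Eab := cmean F (expose W) (fun H => ((a \in H) && (b \in H))%:R : R) G.
pose Eabc := cmean F (expose W) (fun H => ([set a; b; c]%SET \subset H)%:R : R) G.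
have cov_c : edge_mean W c G * Eab - Eabc <= 2^-1 * edge_dev W (c, w) G.
  have -> : Eabc = cmean F (expose W)
      (fun H => (c \in H)%:R * ((a \in H) && (b \in H))%:R) G.
    by apply: eq_cmean => H _; rewrite subE; do 3!case: (_ \in H); rewrite ?mulr1 ?mulr0.
  apply: cmean_cov_le => //; first exact: expose_refines.
  by move=> H1 H2 /[dup] /(mem_expose wa) -> /(mem_expose wb) ->.
have cov_a : edge_mean W a G * edge_mean W b G - Eab <= 2^-1 * edge_dev W (a, v) G.
  have -> : Eab = cmean F (expose W) (fun H => (a \in H)%:R * (b \in H)%:R) G.
    by apply: eq_cmean => H _; do 2!case: (_ \in H); rewrite ?mulr1 ?mulr0.
  apply: cmean_cov_le => //; first exact: expose_refines.
  by move=> H1 H2 /(mem_expose vb) ->.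
have /andP[c0 c1] := mean01 c; have da := edge_dev_ge0 W (a, v) G.
rewrite prodE -/Eabc; apply: le_trans (_ : _ <= 2^-1 * (_ + _)) _; last first.
  by rewrite ler_pM2l ?invr_gt0//; exact: dev2.
have := ler_wpM2l c0 cov_a.
have : edge_mean W c G * (2^-1 * edge_dev W (a, v) G) <= 2^-1 * edge_dev W (a, v) G.
  by rewrite ler_piMl// mulr_ge0// invr_ge0.
by move: cov_c; lra.
Qed.

(** A pair formed by an edge and a vertex completes at most one triangle, so
    the defects of all triangles are controlled by one sum over such pairs. *)
Lemma ntriangles_density W (t : R) G : G \in F ->
  (forall H, H \in F -> (ntriangles H)%:R <= t) ->
  gnq_expect (density R (fiber F (expose W) G)) (fun H => (ntriangles H)%:R) <=
    t + 2^-1 * \sum_p edge_dev W p G.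
Proof.
move=> GF Ft.
have -> : gnq_expect (density R (fiber F (expose W) G)) (fun H => (ntriangles H)%:R) =
    \sum_(T : {set 'I_n} | #|T| == 3%N) \prod_(e in edges_in T) edge_mean W e G.
  under [RHS]eq_bigr => T _ do rewrite -gnq_expect_subset.
  rewrite /gnq_expect exchange_big; apply: eq_bigr => H _.
  by rewrite ntrianglesE mulr_sumr.
have mean_le : \sum_(T : {set 'I_n} | #|T| == 3%N)
    cmean F (expose W) (fun H => (edges_in T \subset H)%:R) G <= t.
  rewrite -cmean_sum -[leRHS](cmean_cst (expose W) t GF).
  by apply: le_cmean => H /Ft; rewrite ntrianglesE.
have dev_le : \sum_(T : {set 'I_n} | #|T| == 3%N)
    \sum_(p : edge n * 'I_n | (p.2 |: val p.1)%SET == T) edge_dev W p G <=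
    \sum_p edge_dev W p G.
  rewrite [leRHS](partition_big (fun p => (p.2 |: val p.1)%SET) predT)//=.
  rewrite [leRHS](bigID (fun T : {set 'I_n} => #|T| == 3%N))/= lerDl.
  by rewrite sumr_ge0// => T _; rewrite sumr_ge0// => p _; exact: edge_dev_ge0.
rewrite -lerBlDl; apply: le_trans (lerB (lexx _) mean_le) _.
have half0 : 0 <= 2^-1 :> R by rewrite invr_ge0.
rewrite -sumrB; apply: le_trans (ler_wpM2l half0 dev_le).
by rewrite mulr_sumr; apply: ler_sum => T /eqP T3; exact: triangle_defect.
Qed.

(** The potential of the energy-increment method: by [sum_cmean_sqrB] it
    never decreases as [W] grows. *)
Definition energy W : R := \sum_e \sum_(G in F) edge_mean W e G ^+ 2.

Lemma energy_bounds W : 0 <= energy W <= #|F|%:R * n%:R ^+ 2.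
Proof.
apply/andP; split.
  by rewrite sumr_ge0// => e _; rewrite sumr_ge0// => G _; rewrite sqr_ge0.
apply: (@le_trans _ _ (\sum_(e : edge n) \sum_(G in F) 1)).
  apply: ler_sum => e _; apply: ler_sum => G _.
  have /andP[m0 m1] : 0 <= edge_mean W e G <= 1 by exact: density_bounds.
  by rewrite expr_le1.
rewrite sumr_const sumr_const -mulrnA -natrX -natrM ler_nat.
by rewrite leq_mul2l expnS expn1 card_edge_le orbT.
Qed.

(** Maximising [energy W - eps * #|F| * #|W|] gives both conclusions at once:
    comparison with the empty set bounds the size of [W], and comparison with
    [x |: W] bounds the increment. *)
Lemma exists_saturated (eps : R) : (0 < #|F|)%N -> 0 < eps ->
  exists W, #|W|%:R * eps <= n%:R ^+ 2 /\
    forall x, energy (x |: W)%SET - energy W <= eps * #|F|%:R.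
Proof.
move=> F0 eps0; have c0 : 0 < #|F|%:R :> R by rewrite ltr0n.
pose f W := energy W - eps * #|F|%:R * #|W|%:R.
have [W _ Wmax] := @Order.TotalTheory.arg_maxP _ R _ finset.set0 predT f isT.
exists W; split.
  have h : f finset.set0 <= f W := Wmax _ isT.
  rewrite /f cards0 mulr0 subr0 in h.
  have /andP[+ _] := energy_bounds finset.set0.
  have /andP[_ +] := energy_bounds W.
  move=> h1 h2; rewrite -(ler_pM2l c0).
  by have -> : #|F|%:R * (#|W|%:R * eps) = eps * #|F|%:R * #|W|%:R by [ring]; move: h; lra.
move=> x; have h : f (x |: W)%SET <= f W := Wmax _ isT.
rewrite /f in h.
have : (#|(x |: W)%SET|%:R : R) <= #|W|%:R + 1.
  by rewrite natr1 ler_nat cardsU1 -[X in (_ <= X)%N]add1n leq_add2r; case: (x \notin W).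
rewrite -(ler_pM2l (mulr_gt0 eps0 c0)); move: h; rewrite mulrDr mulr1; lra.
Qed.

(** By the arithmetic-geometric inequality
    [|d| <= lam / 2 + d ^+ 2 / (2 * lam)], and by [sum_cmean_sqrB] the squares
    [d ^+ 2] sum to an energy increment. *)
Lemma sum_edge_dev_le W (eps lam : R) : 0 < lam ->
  (forall x, energy (x |: W)%SET - energy W <= eps * #|F|%:R) ->
  \sum_(G in F) \sum_p edge_dev W p G <=
    #|F|%:R * (n%:R ^+ 3 * lam / 2 + n%:R * eps / (2 * lam)).
Proof.
move=> lam0 sat; rewrite exchange_big /=.
have step p : \sum_(G in F) edge_dev W p G <= #|F|%:R * lam / 2 +
    (2 * lam)^-1 * (\sum_(G in F) edge_mean (p.2 |: W)%SET p.1 G ^+ 2 -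
                    \sum_(G in F) edge_mean W p.1 G ^+ 2).
  rewrite sum_cmean -sum_cmean_sqrB; last exact: expose_refines.
  rewrite mulr_sumr -mulrA mulr_natl -sumr_const -big_split /=.
  apply: ler_sum => G _; rewrite -/(edge_shift W p G); set d := edge_shift W p G.
  rewrite -subr_ge0 -[d ^+ 2]real_normK ?num_real//.
  have -> : lam / 2 + (2 * lam)^-1 * `|d| ^+ 2 - `|d| = (lam - `|d|) ^+ 2 / (2 * lam).
    by field; exact: lt0r_neq0.
  by rewrite divr_ge0 ?sqr_ge0// mulr_ge0// ltW.
apply: le_trans (ler_sum _ (fun p _ => step p)) _.
rewrite big_split /= sumr_const -mulr_sumr.
have -> : \sum_(p : edge n * 'I_n)
   (\sum_(G in F) edge_mean (p.2 |: W)%SET p.1 G ^+ 2 -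
    \sum_(G in F) edge_mean W p.1 G ^+ 2) = \sum_x (energy (x |: W)%SET - energy W).
  under [RHS]eq_bigr do rewrite -sumrB.
  by rewrite exchange_big pair_bigA.
have satn : \sum_x (energy (x |: W)%SET - energy W) <= n%:R * (eps * #|F|%:R).
  have -> : n%:R * (eps * #|F|%:R) = \sum_(x < n) eps * #|F|%:R.
    by rewrite sumr_const card_ord mulr_natl.
  by apply: ler_sum => x _; exact: sat.
have i0 : 0 <= (2 * lam)^-1 by rewrite invr_ge0 mulr_ge0// ltW.
have cnt : (#|{: edge n * 'I_n}|%:R : R) <= n%:R ^+ 3.
  by rewrite card_prod card_ord -natrX ler_nat !expnSr expn0 mul1n leq_mul2r card_edge_le orbT.
have b0 : 0 <= #|F|%:R * lam / 2 by rewrite divr_ge0// mulr_ge0// ltW.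
rewrite mulrDr; apply: lerD; last first.
  apply: le_trans (ler_wpM2l i0 satn) _; rewrite le_eqVlt; apply/orP; left.
  by apply/eqP; field; exact: lt0r_neq0.
rewrite -[_ *+ _]mulr_natr; apply: le_trans (ler_wpM2l b0 cnt) _.
by rewrite le_eqVlt; apply/orP; left; apply/eqP; ring.
Qed.

End TriangleDefect.

(** * The lower tail bound *)

Lemma ntriangles0 (R : realType) n :
  (ntriangles (finset.set0 : graph n))%:R = 0 :> R.
Proof.
rewrite ntrianglesE big1// => T /eqP /card3_edges[u [v [w [a [b [c [-> _ _ _ _]]]]]]].
by rewrite !finset.subUset finset.sub1set inE.
Qed.

Lemma gnq_prob_half (R : realType) n (A : pred (graph n)) :
  gnq_prob (fun=> 2^-1 : R) A = #|[set G : graph n | A G]%SET|%:R * 2^-1 ^+ #|{: edge n}|.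
Proof.
rewrite /gnq_prob (eq_bigr (fun=> 2^-1 ^+ #|{: edge n}|)) => [|G _].
  rewrite sumr_const -[LHS]mulr_natl; congr (_%:R * _).
  by apply: eq_card => G; rewrite [RHS]inE.
rewrite gnq_massE -[RHS]prodr_const; apply: eq_bigr => e _.
by case: ifP => // _; lra.
Qed.

Lemma card_expose_le n (F : {set graph n}) (W : {set 'I_n}) :
  (#|expose W @: F|%SET <= 2 ^ #|touching W|)%N.
Proof.
rewrite -card_powerset; apply: subset_leq_card.
by apply/fintype.subsetP => _ /imsetP[G _ ->]; rewrite inE finset.subsetIr.
Qed.

Lemma Phi_le (R : realType) n (t : R) (q : edge n -> R) :
  0 <= t -> Qset n t q -> Phi n t <= entropy_cost q.
Proof. by move=> t0; have [p [_ pmin ->]] := Phi_attained n t0; exact: pmin. Qed.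

Theorem theorem1 (R : realType) (n : nat) (hn : (0 < n)%N)
    (t : R) (ht : 0 <= t) :
  ln (gnq_prob (fun _ : edge n => 2^-1 : R)
        (fun G => (ntriangles G)%:R <= t)) <=
    - Phi n (t + n%:R `^ (23%:R / 8%:R)) + 2 * n%:R `^ (15%:R / 8%:R).
Proof.
(* With [y = n ^ (1/8)] all quantities are powers of [y]: the accuracy is
   [lam = 1/y] and the energy tolerance is [eps = (n * lam) ^+ 2 = y ^+ 14]. *)
pose y : R := n%:R `^ 8^-1.
have y1 : 1 <= y.
  rewrite -(powRr0 n%:R); apply: ler_powR; first by rewrite ler1n.
  by rewrite invr_ge0.
have y0 : 0 < y := lt_le_trans ltr01 y1.
have yX m : n%:R `^ (m%:R / 8%:R) = y ^+ m.
  by rewrite mulrC powRrM powR_mulrn// ltW.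
have nE : n%:R = y ^+ 8.
  by rewrite -yX divff ?pnatr_eq0// powRr1.
rewrite !yX.
pose F : {set graph n} := [set G : graph n | (ntriangles G)%:R <= t]%SET.
have F0 : (0 < #|F|)%N.
  by apply/card_gt0P; exists finset.set0; rewrite inE ntriangles0.
have Ft G : G \in F -> (ntriangles G)%:R <= t by rewrite inE.
have c0 : 0 < #|F|%:R :> R by rewrite ltr0n.
have [W [Wcard sat]] := exists_saturated F0 (exprn_gt0 14 y0).
have iy0 : 0 < y^-1 by rewrite invr_gt0.
have dev_le := sum_edge_dev_le iy0 sat.
have h0 G : G \in F -> 0 <= 2^-1 * \sum_p edge_dev R F W p G.
  by move=> _; rewrite mulr_ge0 ?invr_ge0// sumr_ge0// => p _; exact: edge_dev_ge0.
have hd : \sum_(G in F) 2^-1 * \sum_p edge_dev R F W p G <= #|F|%:R * y ^+ 23 / 2.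
  rewrite -mulr_sumr mulrC ler_pM2r ?invr_gt0//; apply: le_trans dev_le _.
  rewrite nE le_eqVlt; apply/orP; left; apply/eqP.
  by field; exact: lt0r_neq0.
have [G [GF hG big]] := exists_large_fiber (expose W) F0 (exprn_gt0 23 y0) h0 hd.
set H := fiber F (expose W) G in big.
have H0 : (0 < #|H|)%N by apply/card_gt0P; exists G; exact: mem_fiber.
have cost_le : Phi n (t + y ^+ 23) <= entropy_cost (density R H).
  apply: Phi_le; first by rewrite addr_ge0// exprn_ge0// ltW.
  split=> [e|]; first exact: density_bounds.
  by apply: le_trans (ntriangles_density W GF Ft) _; rewrite lerD2l.
(* Here [#|W| <= n ^+ 2 / eps = y ^+ 2], and each vertex meets at most [n] edges. *)
have touch_le : #|touching W|%:R <= y ^+ 10 :> R.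
  apply: (@le_trans _ _ (#|W|%:R * n%:R)).
    by rewrite -natrM ler_nat card_touching.
  rewrite nE (exprD y 2 8) ler_pM2r ?exprn_gt0//.
  by rewrite -(ler_pM2r (exprn_gt0 14 y0)) -exprD (le_trans Wcard)// nE -exprM.
have lnF : ln #|F|%:R <= (#|touching W|%:R + 1) * ln 2 + ln #|H|%:R :> R.
  have p0 : 0 < 2 ^+ #|touching W|.+1 :> R by rewrite exprn_gt0.
  have -> : (#|touching W|%:R + 1) * ln 2 = ln (2 ^+ #|touching W|.+1) :> R.
    by rewrite lnXn// natr1 mulr_natl.
  rewrite -lnM ?posrE ?ltr0n// ler_ln ?posrE ?mulr_gt0 ?ltr0n//.
  apply: le_trans big _; rewrite ler_pM2r ?ltr0n// exprS ler_pM2l//.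
  by rewrite -natrX ler_nat card_expose_le.
have ln2_le1 : ln 2 <= 1 :> R.
  by have := @le_ln1Dx R 1; apply; rewrite (lt_trans (ltrN10 _)).
have y1015 : y ^+ 10 <= y ^+ 15 by apply: ler_weXn2l.
have y15 : 1 <= y ^+ 15 by rewrite exprn_ege1.
have lnS : (#|touching W|%:R + 1) * ln 2 <= y ^+ 10 + 1.
  apply: le_trans (ler_wpM2l _ ln2_le1) _; first by rewrite addr_ge0.
  by rewrite mulr1 lerD2r.
have := entropy_subadditive R H0.
rewrite gnq_prob_half lnM ?posrE ?exprn_gt0 ?invr_gt0//.
rewrite exprVn lnV ?posrE ?exprn_gt0// lnXn// -[ln 2 *+ _]mulr_natl.
by lra.
Qed.
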